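(* Let $F$ be a field and let $\mathcal{A},\mathcal{A}'$ be finitely presented $F$-algebras, each of which has a finite-dimensional representation. Then the free product $\mathcal{A}*\mathcal{A}'$ is rank-stable if and only if both $\mathcal{A}$ and $\mathcal{A}'$ are rank-stable.
   Context: Algebras are associative and unital over a field $F$; $F\langle x_1,\dots,x_d\rangle$ denotes the free associative unital algebra (non-commutative polynomials). A finite-dimensional representation of an algebra is a unital algebra homomorphism to $M_n(F)$ for some $n\ge1$. The free product $\mathcal{A}*\mathcal{A}'$ is the coproduct of unital $F$-algebras: if $\mathcal{A}=F\langle x_1,\dots,x_d\rangle/\langle P_1,\dots,P_r\rangle$ and $\mathcal{A}'=F\langle y_1,\dots,y_e\rangle/\langle Q_1,\dots,Q_s\rangle$ then $\mathcal{A}*\mathcal{A}'=F\langle x_1,\dots,x_d,y_1,\dots,y_e\rangle/\langle P_1,\dots,P_r,Q_1,\dots,Q_s\rangle$. For $A\in M_n(F)$ let $\operatorname{rank}(A)=\dim_F\operatorname{Im}A$ and let $\operatorname{rk}(A)=\frac1n\operatorname{rank}(A)$ (normalized rank). For $A\in M_n(F)$, $\widehat{A}$ is the finitely supported $\mathbb{N}\times\mathbb{N}$ matrix that agrees with $A$ in entries $(i,j)$ with $1\le i,j\le n$ and is zero elsewhere. When matrices in $M_n(F)$ are substituted into a non-commutative polynomial, constant terms are interpreted as scalar $n\times n$ matrices. A finitely presented algebra $F\langle x_1,\dots,x_d\rangle/\langle P_1,\dots,P_r\rangle$ is rank-stable if for every $\varepsilon>0$ there exists $\delta>0$ such that for every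 $n\ge 1$ and every tuple $A_1,\dots,A_d\in M_n(F)$ with $\operatorname{rk}P_i(A_1,\dots,A_d)<\delta$ for all $1\le i\le r$, there exist $n'\ge 1$ and $B_1,\dots,B_d\in M_{n'}(F)$ with $P_i(B_1,\dots,B_d)=0$ for all $1\le i\le r$ and $\operatorname{rank}(\widehat{A_i}-\widehat{B_i})<\varepsilon n$ for all $1\le i\le d$. (This property does not depend on the chosen finite presentation of the algebra.) *)

(* Defs.v *)
From HB Require Import structures.
From mathcomp Require Import all_boot all_order all_algebra.
From mathcomp Require Import reals.
From mathcomp.multinomials Require Import monalg.

Set Implicit Arguments.
Unset Strict Implicit.
Unset Printing Implicit Defensive.

Import Order.TTheory GRing.Theory Num.Theory.

Local Open Scope ring_scope.

(* F<x_0, ..., x_(d-1)>: the monoid algebra over F of the free monoid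
   {fmonom 'I_d} of words in d letters. *)
Notation ncpoly F d := {malg F[{fmonom 'I_d}]}.

(* Value of p when the letters are replaced by the x i; the constant term c
   becomes c%:A, which is c%:M when A is a matrix algebra. *)
Definition nc_eval (F : fieldType) (A : algType F) (d : nat) (x : 'I_d -> A)
    (p : ncpoly F d) : A :=
  mmap (in_alg A) (fun w : {fmonom 'I_d} => \prod_(i <- w) x i) p.

Definition in_ideal (F : fieldType) (d : nat) (P : seq (ncpoly F d))
    (q : ncpoly F d) : Prop :=
  exists s : seq (ncpoly F d * ncpoly F d * ncpoly F d),
    (forall t, t \in s -> t.1.2 \in P) /\
    q = \sum_(t <- s) t.1.1 * t.1.2 * t.2.

(* Evaluation at x induces an isomorphism F<x_0, ..., x_(d-1)> / <P> -> A. *)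
Definition presents (F : fieldType) (A : algType F) (d : nat) (x : 'I_d -> A)
    (P : seq (ncpoly F d)) : Prop :=
  (forall a : A, exists q, nc_eval x q = a) /\
  (forall q, nc_eval x q = 0 <-> in_ideal P q).

Definition finitely_presented (F : fieldType) (A : algType F) : Prop :=
  exists (d : nat) (x : 'I_d -> A) (P : seq (ncpoly F d)), presents x P.

Definition has_findim_rep (F : fieldType) (A : algType F) : Prop :=
  exists n : nat, inhabited {lrmorphism A -> 'M[F]_n.+1}.

(* An algType is a nonzero ring. Allowing the zero algebra as a test object D
   would change nothing, since every algebra has exactly one map to it. *)
Definition is_free_product (F : fieldType) (A A' C : algType F)
    (i : {lrmorphism A -> C}) (i' : {lrmorphism A' -> C}) : Prop :=
  forall (D : algType F) (f : {lrmorphism A -> D}) (f' : {lrmorphism A' -> D}),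
    exists h : {lrmorphism C -> D},
      [/\ forall a, h (i a) = f a,
          forall a', h (i' a') = f' a'
        & forall k : {lrmorphism C -> D},
            (forall a, k (i a) = f a) -> (forall a', k (i' a') = f' a') ->
            forall c, k c = h c].

Definition rk (R : realType) (F : fieldType) (n : nat) (A : 'M[F]_n) : R :=
  (\rank A)%:R / n%:R.

Definition hat (F : fieldType) (n : nat) (A : 'M[F]_n) (i j : nat) : F :=
  if insub i is Some i' then if insub j is Some j' then A i' j' else 0 else 0.

(* hat A and hat B are both supported on the leading square block of size
   maxn n n', so the rank of their difference is the rank of that block. *)
Definition rank_hatB (F : fieldType) (n n' : nat) (A : 'M[F]_n) (B : 'M[F]_n')
    : nat :=
  \rank (\matrix_(i < maxn n n', j < maxn n n') (hat A i j - hat B i j)).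

Definition rank_stable_presentation (R : realType) (F : fieldType) (d : nat)
    (P : seq (ncpoly F d)) : Prop :=
  forall eps : R, 0 < eps ->
  exists2 delta : R, 0 < delta &
  forall (n : nat) (A : 'I_d -> 'M[F]_n.+1),
    (forall p, p \in P -> rk R (nc_eval A p) < delta) ->
    exists (n' : nat) (B : 'I_d -> 'M[F]_n'.+1),
      (forall p, p \in P -> nc_eval B p = 0) /\
      (forall i : 'I_d, (rank_hatB (A i) (B i))%:R < eps * n.+1%:R).

(* The choice of the finite presentation is immaterial. *)
Definition rank_stable (R : realType) (F : fieldType) (A : algType F) : Prop :=
  exists (d : nat) (x : 'I_d -> A) (P : seq (ncpoly F d)),
    presents x P /\ rank_stable_presentation R P.

(* Main.v *)
(** Rank-stability has a basis-free form. Tuples [A], [B] of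
    square matrices of sizes [n], [n'] are [e]-close when some [n * n'] matrix
    [T], invertible up to corank [e], intertwines them up to rank [e].
    Evaluating a fixed noncommutative polynomial multiplies [e] by a constant at
    most. A solution [B] provided by rank-stability may have the wrong size, but
    it can be corrected: if [n' > n], restrict [B] to an invariant subspace
    slightly larger than [F^n]; if [n' < n], either the size defect is small or
    all relators have zero constant term, and then [B] is extended by zeros.
    This gives independence of the presentation.

    If the free product is stable, an almost solution of the relators of the
    first factor is completed by copies of a representation of the second factor
    (plus a few zeros). Conversely, two solutions of nearly equal sizes are
    brought to the same size by adding a bounded number of representations to
    make the sizes multiples of a common representation dimension [L], then
    copies of [L]-dimensional ones. Bounded errors matter only for bounded [n],
    where a small normalized rank is zero. *)

From HB Require Import structures.
From mathcomp Require Import all_boot all_order all_algebra.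
From mathcomp Require Import generic_quotient ring_quotient zify.
From mathcomp Require Import boolp reals.
From mathcomp.multinomials Require Import monalg.
Require Import Defs.

Set Implicit Arguments.
Unset Strict Implicit.
Unset Printing Implicit Defensive.

Import Order.TTheory GRing.Theory Num.Theory.

Local Open Scope ring_scope.

(** * Evaluation of noncommutative polynomials *)

(* An alias is needed because [malg] already has a canonical algebra structure,
   restricted to commutative monoids. *)
Definition freealg (F : fieldType) (d : nat) : Type := ncpoly F d.

Section FreeAlgebra.
Variables (F : fieldType) (d : nat).

Lemma ncpoly_scaleAr (c : F) (p q : ncpoly F d) : c *: (p * q) = p * (c *: q).
Proof.
have [->|c0] := eqVneq c 0; first by rewrite !scale0r mulr0.
apply/malgP => k; rewrite mcoeffZ !mcoeffMl mulr_sumr; apply: eq_bigr => i _.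
rewrite msuppZ (negPf c0) mulr_sumr; apply: eq_bigr => j _.
by rewrite mcoeffZ mulrnAr mulrCA.
Qed.

HB.instance Definition _ := GRing.Lalgebra.copy (freealg F d) (ncpoly F d).
HB.instance Definition _ :=
  GRing.Lalgebra_isAlgebra.Build F (freealg F d) ncpoly_scaleAr.

End FreeAlgebra.

Definition letter (F : fieldType) (d : nat) (j : 'I_d) : ncpoly F d :=
  << fmu j >>.

Section Evaluation.
Variable F : fieldType.

Section FixedLetters.
Variable d : nat.
Implicit Types (p q : ncpoly F d).

(** Polynomials are combinations of words, and words are built from the empty one by multiplying
    letters. *)
Lemma ncpoly_ind (Q : ncpoly F d -> Prop) :
    Q 1 -> (forall j, Q (letter F j)) ->
    (forall p q, Q p -> Q q -> Q (p + q)) ->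
    (forall p q, Q p -> Q q -> Q (p * q)) ->
    (forall c p, Q p -> Q (c *: p)) ->
  forall p, Q p.
Proof.
move=> Q1 Ql QD QM QZ p; rewrite [p]monalgE.
have Q0 : Q 0 by rewrite -(scale0r 1); apply: QZ.
apply: (big_ind Q) => // w _.
have Uw : << p@_w *g w >> = p@_w *: (<< w >> : ncpoly F d).
  by apply/malgP => k; rewrite mcoeffZ !mcoeffU mulr_natr.
rewrite Uw; apply: QZ; rewrite -[w]fmK; elim: (fmonom_val w) => [|j s IHs].
  suff -> : << FMonom [::] >> = 1 :> ncpoly F d by [].
  by apply/malgP => k; rewrite mcoeff1 mcoeffU1 -fmoneE eq_sym.
suff -> : << FMonom (j :: s) >> = letter F j * << FMonom s >> :> ncpoly F d.
  exact: QM.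
by rewrite malgM_def fgmulUU mulr1 /letter fmuE /mmul /= fmmulE.
Qed.

Section Morphism.
Variables (A : algType F) (x : 'I_d -> A).

Let h (w : {fmonom 'I_d}) : A := \prod_(i <- w) x i.

Let h_mmorphism : mmorphism h.
Proof.
split=> [u v|]; first by rewrite /h fmM big_cat.
by rewrite /h fm1 big_nil.
Qed.

HB.instance Definition _ := isMultiplicative.Build _ _ h h_mmorphism.

Lemma nc_eval_is_zmod_morphism : zmod_morphism (nc_eval x).
Proof. exact: raddfB. Qed.

Lemma nc_eval_is_monoid_morphism : monoid_morphism (nc_eval x).
Proof.
suff: multiplicative (nc_eval x) by case.
apply: (@commr_mmap_is_multiplicative _ _ _ (in_alg A) h) => p u v.
by rewrite /GRing.comm /= -scalerAl -scalerAr mul1r mulr1.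
Qed.

Lemma nc_eval_is_scalable : scalable (nc_eval x).
Proof.
move=> c p; rewrite /nc_eval (@mmapZ _ _ _ (in_alg A) h) /=.
by rewrite -scalerAl mul1r.
Qed.

HB.instance Definition _ :=
  GRing.isZmodMorphism.Build _ _ (nc_eval x) nc_eval_is_zmod_morphism.
HB.instance Definition _ :=
  GRing.isMonoidMorphism.Build _ _ (nc_eval x) nc_eval_is_monoid_morphism.
HB.instance Definition _ :=
  GRing.isScalable.Build _ _ _ _ (nc_eval x) nc_eval_is_scalable.

Lemma nc_eval_letter j : nc_eval x (letter F j) = x j.
Proof.
rewrite /nc_eval /letter (@mmapU _ _ _ (in_alg A)) /= scale1r mul1r.
by rewrite fmU big_seq1.
Qed.

End Morphism.

Lemma eq_nc_eval (A : algType F) (x y : 'I_d -> A) :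
  x =1 y -> nc_eval x =1 nc_eval y.
Proof. by move=> /funext ->. Qed.

Lemma lrmorph_ncpoly (A : algType F) (f : {lrmorphism ncpoly F d -> A}) p :
  f p = nc_eval (fun j => f (letter F j)) p.
Proof.
elim/ncpoly_ind: p => [|j|p q IHp IHq|p q IHp IHq|c p IHp].
- by rewrite !rmorph1.
- by rewrite nc_eval_letter.
- by rewrite !raddfD /= IHp IHq.
- by rewrite !rmorphM /= IHp IHq.
- by rewrite !linearZ /= IHp.
Qed.

Lemma lrmorph_nc_eval (A B : algType F) (f : {lrmorphism A -> B})
    (x : 'I_d -> A) p :
  f (nc_eval x p) = nc_eval (fun j => f (x j)) p.
Proof.
rewrite -[LHS]/((f \o nc_eval x) p) lrmorph_ncpoly.
by apply: eq_nc_eval => j /=; rewrite nc_eval_letter.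
Qed.

End FixedLetters.

(** Evaluation takes place in [freealg], whose algebra structure needs no commutativity, while the
    result stays typed as a polynomial. *)
Definition nc_subst d k (g : 'I_k -> ncpoly F d) (p : ncpoly F k) : ncpoly F d :=
  @nc_eval F (freealg F d) k g p.

HB.instance Definition _ d k (g : 'I_k -> ncpoly F d) :=
  GRing.LRMorphism.copy (nc_subst g) (@nc_eval F (freealg F d) k g).

Lemma nc_subst_letter d k (g : 'I_k -> ncpoly F d) j :
  nc_subst g (letter F j) = g j.
Proof. exact: (@nc_eval_letter k (freealg F d) g j). Qed.

Lemma nc_eval_subst (A : algType F) d k (g : 'I_k -> ncpoly F d) (x : 'I_d -> A) p :
  nc_eval x (nc_subst g p) = nc_eval (fun j => nc_eval x (g j)) p.
Proof.
rewrite -[LHS]/((nc_eval x \o nc_subst g) p) lrmorph_ncpoly.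
by apply: eq_nc_eval => j /=; rewrite nc_subst_letter.
Qed.

End Evaluation.

(** * Ideals generated by relators *)

Section Ideals.
Variables (F : fieldType) (d : nat) (P : seq (ncpoly F d)).

Lemma in_ideal_gen p : p \in P -> in_ideal P p.
Proof.
move=> pP; exists [:: (1, p, 1)]; split=> [t|]; first by rewrite inE => /eqP ->.
by rewrite big_seq1 /= mul1r mulr1.
Qed.

Lemma in_ideal0 : in_ideal P 0.
Proof. by exists [::]; rewrite big_nil. Qed.

Lemma in_idealD p q : in_ideal P p -> in_ideal P q -> in_ideal P (p + q).
Proof.
move=> [s [sP ->]] [t [tP ->]]; exists (s ++ t); rewrite big_cat; split=> // u.
by rewrite mem_cat => /orP[/sP|/tP].
Qed.

Lemma in_idealM a p b : in_ideal P p -> in_ideal P (a * p * b).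
Proof.
move=> [s [sP ->]]; exists [seq (a * t.1.1, t.1.2, t.2 * b) | t <- s]; split.
  by move=> u /mapP[t /sP tP ->].
rewrite big_map mulr_sumr mulr_suml; apply: eq_bigr => t _ /=.
by rewrite !mulrA.
Qed.

Lemma in_idealMl a p : in_ideal P p -> in_ideal P (a * p).
Proof. by rewrite -[a * p]mulr1; apply: in_idealM. Qed.

Lemma in_idealMr p b : in_ideal P p -> in_ideal P (p * b).
Proof. by move=> /(in_idealM 1 b); rewrite mul1r. Qed.

Lemma in_idealN p : in_ideal P p -> in_ideal P (- p).
Proof. by rewrite -mulN1r; apply: in_idealMl. Qed.

Lemma in_idealB p q : in_ideal P p -> in_ideal P q -> in_ideal P (p - q).
Proof. by move=> Pp /in_idealN; apply: in_idealD. Qed.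

Lemma in_ideal_ind (Q : ncpoly F d -> Prop) :
    Q 0 -> (forall p q, Q p -> Q q -> Q (p + q)) ->
    (forall a p b, p \in P -> Q (a * p * b)) ->
  forall p, in_ideal P p -> Q p.
Proof.
move=> Q0 QD QP p [s [sP ->]]; rewrite big_seq.
by apply: (big_ind Q) => // t /sP; apply: QP.
Qed.

Lemma eval_ideal0 (A : algType F) (x : 'I_d -> A) q :
  (forall p, p \in P -> nc_eval x p = 0) -> in_ideal P q -> nc_eval x q = 0.
Proof.
move=> xP; elim/in_ideal_ind=> [|p r Hp Hr|a p b /xP Hp]; first exact: raddf0.
  by rewrite raddfD /= Hp Hr addr0.
by rewrite !rmorphM /= Hp mulr0 mul0r.
Qed.

Lemma presents_gen0 (A : algType F) (x : 'I_d -> A) p :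
  presents x P -> p \in P -> nc_eval x p = 0.
Proof. by move=> [_ xP] /in_ideal_gen /xP. Qed.

End Ideals.

(** * Rank perturbation *)

(** Serves to choose one rank constant for a whole finite list of polynomials: the largest one. *)
Lemma uniform_seq (T : eqType) (s : seq T) (Q : T -> nat -> Prop) :
    (forall x c c', (c <= c')%N -> Q x c -> Q x c') ->
    (forall x, exists c, Q x c) ->
  exists c, forall x, x \in s -> Q x c.
Proof.
move=> Qmono Qex; elim: s => [|x s [c IHs]]; first by exists 0%N.
have [c' Qx] := Qex x; exists (maxn c c') => y; rewrite inE => /orP[/eqP ->|ys].
  by apply: Qmono Qx; rewrite leq_maxr.
by apply: Qmono (IHs _ ys); rewrite leq_maxl.
Qed.

Section RankPerturbation.
Variables (F : fieldType) (d : nat).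

Lemma mxrank_sub m n (A B : 'M[F]_(m, n)) :
  (\rank (A - B)%R <= \rank A + \rank B)%N.
Proof. by rewrite (leq_trans (mxrank_add _ _)) // mxrank_opp. Qed.

Lemma leq_rankM m n p q (A : 'M[F]_(m, n)) (B : 'M_(n, p)) (C : 'M_(p, q)) :
  (\rank (A *m B *m C) <= \rank B)%N.
Proof. exact: leq_trans (mxrankM_maxl _ _) (mxrankM_maxr _ _). Qed.

(** Induction on [p]. On products the error obeys a Leibniz rule, and multiplying by a matrix never
    raises the rank, so the constants add up. They depend on neither the sizes nor [T]. *)
Lemma nc_eval_perturb (p : ncpoly F d) : exists C, forall n n'
    (X : 'I_d -> 'M[F]_n.+1) (Y : 'I_d -> 'M[F]_n'.+1) (T : 'M_(n.+1, n'.+1)) e,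
  (forall j, (\rank (X j *m T - T *m Y j)%R <= e)%N) ->
  (\rank (nc_eval X p *m T - T *m nc_eval Y p)%R <= C * e)%N.
Proof.
elim/ncpoly_ind: p => [|j|p q [C HC] [C' HC']|p q [C HC] [C' HC']|c p [C HC]].
- by exists 0%N => n n' X Y T e _; rewrite !rmorph1 mul1mx mulmx1 subrr mxrank0.
- by exists 1%N => n n' X Y T e H; rewrite !nc_eval_letter mul1n.
- exists (C + C')%N => n n' X Y T e H.
  rewrite (raddfD (nc_eval X)) (raddfD (nc_eval Y)) mulmxDl mulmxDr.
  rewrite opprD addrACA mulnDl (leq_trans (mxrank_add _ _)) // leq_add //.
    exact: HC.
  exact: HC'.
- exists (C + C')%N => n n' X Y T e H; rewrite !rmorphM /= -!mulmxE.
  set pX := nc_eval X p; set qX := nc_eval X q.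
  set pY := nc_eval Y p; set qY := nc_eval Y q.
  have -> : pX *m qX *m T - T *m (pY *m qY) =
      (pX *m T - T *m pY) *m qY + pX *m (qX *m T - T *m qY).
    by rewrite mulmxBl mulmxBr !mulmxA [RHS]addrC subrKA.
  rewrite mulnDl (leq_trans (mxrank_add _ _)) // leq_add //.
    by rewrite (leq_trans (mxrankM_maxl _ _)) // HC.
  by rewrite (leq_trans (mxrankM_maxr _ _)) // HC'.
- exists C => n n' X Y T e H; rewrite [nc_eval X _]linearZ [nc_eval Y _]linearZ /=.
  rewrite -scalemxAl -scalemxAr -scalerBr.
  by rewrite (leq_trans (mxrankS (scalemx_sub _ (submx_refl _)))) // HC.
Qed.

Lemma nc_eval_intertwine (p : ncpoly F d) n n' (X : 'I_d -> 'M[F]_n.+1)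
    (Y : 'I_d -> 'M[F]_n'.+1) (T : 'M_(n.+1, n'.+1)) :
  (forall j, X j *m T = T *m Y j) -> nc_eval X p *m T = T *m nc_eval Y p.
Proof.
move=> H; have [C HC] := nc_eval_perturb p.
apply/eqP; rewrite -subr_eq0 -mxrank_eq0 -leqn0 -(muln0 C) HC // => j.
by rewrite H subrr mxrank0.
Qed.

Lemma nc_eval_conj0 (p : ncpoly F d) n (B : 'I_d -> 'M[F]_n.+1) (g : 'M_n.+1) :
  g \in unitmx -> nc_eval B p = 0 ->
  nc_eval (fun j => g *m B j *m invmx g) p = 0.
Proof.
move=> gU Bp; have := @nc_eval_intertwine p _ _ (fun j => g *m B j *m invmx g) B g.
rewrite Bp mulmx0 => H; rewrite -[LHS](mulmxK gU) H ?mul0mx // => j.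
by rewrite mulmxKV.
Qed.

Lemma nc_eval_uniform (P : seq (ncpoly F d)) : exists C, forall p n n'
    (X : 'I_d -> 'M[F]_n.+1) (Y : 'I_d -> 'M[F]_n'.+1) (T : 'M_(n.+1, n'.+1)) e,
  p \in P -> (forall j, (\rank (X j *m T - T *m Y j)%R <= e)%N) ->
  (\rank (nc_eval X p *m T - T *m nc_eval Y p)%R <= C * e)%N.
Proof.
have [|C HC] := @uniform_seq _ P _ _ nc_eval_perturb.
  move=> p c c' le_cc' Hc n n' X Y T e /Hc /leq_trans -> //.
  by rewrite leq_mul2r le_cc' orbT.
by exists C => p n n' X Y T e pP; apply: HC.
Qed.

End RankPerturbation.

(** * Padded matrices and their differences *)

Section Hat.
Variable F : fieldType.

Lemma hatE N n (A : 'M[F]_n) : (n <= N)%N ->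
  \matrix_(i < N, j < N) hat A i j =
  (pid_mx n : 'M_(N, n)) *m A *m (pid_mx n : 'M_(n, N)).
Proof.
move=> /subnKC <-; set k := (N - n)%N.
rewrite pid_mx_col pid_mx_row mul_col_mx mul1mx mul0mx mul_col_mx mul0mx.
rewrite mul_mx_row mulmx1 mulmx0; apply/matrixP => i j; rewrite !mxE /hat.
case: splitP => i' ->; last first.
  by rewrite insubF ?mxE // ltnNge leq_addr.
rewrite insubT // => lt_i; rewrite !mxE; case: splitP => j' ->; last first.
  by rewrite insubF ?mxE // ltnNge leq_addr.
by rewrite insubT // => lt_j; congr (A _ _); apply: val_inj.
Qed.

Lemma rank_hatBE N n n' (A : 'M[F]_n) (B : 'M[F]_n') : N = maxn n n' ->
  rank_hatB A B = \rank ((pid_mx n : 'M_(N, n)) *m A *m (pid_mx n : 'M_(n, N)) -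
                         (pid_mx n' : 'M_(N, n')) *m B *m (pid_mx n' : 'M_(n', N))).
Proof.
move=> ->; rewrite -!hatE ?leq_maxl ?leq_maxr // /rank_hatB; congr (\rank _).
by apply/matrixP => i j; rewrite !mxE.
Qed.

Lemma pid_mxK n N : (n <= N)%N ->
  (pid_mx n : 'M[F]_(n, N)) *m (pid_mx n : 'M_(N, n)) = 1%:M.
Proof. by move=> le_nN; rewrite mul_pid_mx minnn (minn_idPr _) // pid_mx_1. Qed.

(** The left side is the padded difference cut down to the first [n] rows and [n'] columns. *)
Lemma leq_rank_pid n n' (A : 'M[F]_n) (B : 'M[F]_n') :
  (\rank (A *m pid_mx n' - (pid_mx n' : 'M_(n, n')) *m B)%R <= rank_hatB A B)%N.
Proof.
rewrite (rank_hatBE _ _ (erefl _)); set N := maxn n n'.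
have le_nN : (n <= N)%N := leq_maxl n n'.
have le_n'N : (n' <= N)%N := leq_maxr n n'.
set E : 'M_(N, n) := pid_mx n; set Et : 'M_(n, N) := pid_mx n.
set E' : 'M_(N, n') := pid_mx n'; set Et' : 'M_(n', N) := pid_mx n'.
have -> : (pid_mx n' : 'M[F]_(n, n')) = Et *m E'.
  have le_N : (minn n n' <= N)%N by rewrite geq_min le_nN.
  by rewrite mul_pid_mx (minn_idPr le_N) pid_mx_minv.
have -> : A *m (Et *m E') - Et *m E' *m B =
    Et *m (E *m A *m Et - E' *m B *m Et') *m E'.
  rewrite mulmxBr mulmxBl !mulmxA pid_mxK // mul1mx.
  by rewrite -(mulmxA _ Et' E') pid_mxK // mulmx1.
exact: leq_rankM.
Qed.

(** A converse to [leq_rank_pid]: the compression misses only the columns of the padded [A] beyond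
    [n'] and the rows of the padded [B] beyond [n]. *)
Lemma rank_hatB_leq n n' (A : 'M[F]_n) (B : 'M[F]_n') : (rank_hatB A B <=
  \rank (A *m pid_mx n' - (pid_mx n' : 'M_(n, n')) *m B)%R +
  (maxn n n' - n + (maxn n n' - n')))%N.
Proof.
rewrite (rank_hatBE _ _ (erefl _)); set N := maxn n n'.
have le_nN : (n <= N)%N := leq_maxl n n'.
have le_n'N : (n' <= N)%N := leq_maxr n n'.
set E : 'M_(N, n) := pid_mx n; set Et : 'M_(n, N) := pid_mx n.
set E' : 'M_(N, n') := pid_mx n'; set Et' : 'M_(n', N) := pid_mx n'.
have -> : (pid_mx n' : 'M[F]_(n, n')) = Et *m E'.
  have le_N : (minn n n' <= N)%N by rewrite geq_min le_nN.
  by rewrite mul_pid_mx (minn_idPr le_N) pid_mx_minv.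
set D := A *m _ - _.
have -> : E *m A *m Et - E' *m B *m Et' =
    E *m D *m Et' + (E *m A *m Et *m copid_mx n' -
                     copid_mx n *m (E' *m B *m Et')).
  have EE : E *m Et = pid_mx n by rewrite mul_pid_mx !minnn.
  have EE' : E' *m Et' = pid_mx n' by rewrite mul_pid_mx !minnn.
  rewrite /D /copid_mx -EE -EE' mulmxBr mulmxBl mulmxBr mulmxBl.
  rewrite !mulmxA mulmx1 mul1mx.
  set u := E *m A *m Et; set v := E' *m B *m Et'.
  by rewrite opprB addrA [X in _ = X + _]addrC !subrKA.
rewrite (leq_trans (mxrank_add _ _)) // leq_add ?leq_rankM // addnC.
rewrite (leq_trans (mxrank_sub _ _)) // leq_add //.
  by rewrite (leq_trans (mxrankM_maxr _ _)) // rank_copid_mx.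
by rewrite (leq_trans (mxrankM_maxl _ _)) // rank_copid_mx.
Qed.

End Hat.

(** * Close tuples of matrices *)

Section Closeness.
Variable F : fieldType.

(* [T] is an isomorphism up to corank [e] that intertwines the two tuples up to
   rank [e], so closeness ignores the choice of bases in the two spaces. *)
Definition close (e d n n' : nat) (A : 'I_d -> 'M[F]_n.+1)
    (B : 'I_d -> 'M[F]_n'.+1) : Prop :=
  exists T : 'M[F]_(n.+1, n'.+1),
    [/\ forall j, (\rank (A j *m T - T *m B j)%R <= e)%N,
        (n.+1 <= \rank T + e)%N & (n'.+1 <= \rank T + e)%N].

Lemma close_refl d n (A : 'I_d -> 'M[F]_n.+1) : close 0 A A.
Proof.
exists 1%:M; split=> [j||]; rewrite ?mxrank1 ?addn0 //.
by rewrite mul1mx mulmx1 subrr mxrank0.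
Qed.

Lemma close_le e e' d n n' (A : 'I_d -> 'M[F]_n.+1) (B : 'I_d -> 'M[F]_n'.+1) :
  (e <= e')%N -> close e A B -> close e' A B.
Proof.
move=> le_ee' [T [HT rn rn']]; exists T; split=> [j||].
- exact: leq_trans (HT j) le_ee'.
- by rewrite (leq_trans rn) // leq_add2l.
- by rewrite (leq_trans rn') // leq_add2l.
Qed.

Lemma close_dim e d n n' (A : 'I_d -> 'M[F]_n.+1) (B : 'I_d -> 'M[F]_n'.+1) :
  close e A B -> (n <= n' + e)%N /\ (n' <= n + e)%N.
Proof.
move=> [T [_ rn rn']]; rewrite -(leq_add2r 1) -[(n' <= _)%N](leq_add2r 1) !addn1.
split.
  by rewrite (leq_trans rn) // -addSn leq_add2r rank_leq_col.
by rewrite (leq_trans rn') // -addSn leq_add2r rank_leq_row.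
Qed.

Lemma close_sub d e e' n n' (A A' : 'I_d -> 'M[F]_n.+1)
    (B : 'I_d -> 'M[F]_n'.+1) :
  (forall j, (\rank (A' j - A j)%R <= e')%N) -> close e A B ->
  close (e + e') A' B.
Proof.
move=> HA [T [HT rn rn']]; exists T; split=> [j||].
- have -> : A' j *m T - T *m B j = (A j *m T - T *m B j) + (A' j - A j) *m T.
    by rewrite mulmxBl [RHS]addrC subrKA.
  rewrite (leq_trans (mxrank_add _ _)) // leq_add //.
  exact: leq_trans (mxrankM_maxl _ _) (HA j).
- by rewrite addnA (leq_trans rn) // leq_addr.
- by rewrite addnA (leq_trans rn') // leq_addr.
Qed.

Lemma close_eval d k (f : 'I_k -> ncpoly F d) : exists C, forall e n n'
    (A : 'I_d -> 'M[F]_n.+1) (B : 'I_d -> 'M[F]_n'.+1),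
  close e A B ->
  close (C * e) (fun j => nc_eval A (f j)) (fun j => nc_eval B (f j)).
Proof.
have [C HC] := nc_eval_uniform (codom f).
(* [C] bounds the intertwining error; one more [e] keeps the corank bound, even if [C] is 0. *)
exists C.+1 => e n n' A B [T [HT rn rn']]; exists T; split=> [j||].
- rewrite mulSn (leq_trans _ (leq_addl _ _)) //.
  by apply: HC HT; apply: codom_f.
- by rewrite mulSn addnA (leq_trans rn) // leq_addr.
- by rewrite mulSn addnA (leq_trans rn') // leq_addr.
Qed.

(** The size is visibly a successor, yet convertible to [m.+1 + n.+1]. *)
Definition dsum m n (A : 'M[F]_m.+1) (B : 'M[F]_n.+1) : 'M[F]_((m + n.+1).+1) :=
  block_mx A 0 0 B.

Lemma block_diag_row_mxl m n (A : 'M[F]_m) (B : 'M[F]_n) :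
  A *m row_mx 1%:M 0 = row_mx 1%:M 0 *m block_mx A 0 0 B.
Proof.
by rewrite mul_mx_row mul_row_block !mulmx1 !mulmx0 !mul1mx !mul0mx !addr0.
Qed.

Lemma block_diag_row_mxr m n (A : 'M[F]_m) (B : 'M[F]_n) :
  B *m row_mx 0 1%:M = row_mx 0 1%:M *m block_mx A 0 0 B.
Proof.
by rewrite mul_mx_row mul_row_block !mulmx1 !mulmx0 !mul1mx !mul0mx !add0r.
Qed.

Lemma block_diag_uniq m n (A : 'M[F]_m) (B : 'M[F]_n) (M : 'M[F]_(m + n)) :
  A *m row_mx 1%:M 0 = row_mx 1%:M 0 *m M ->
  B *m row_mx 0 1%:M = row_mx 0 1%:M *m M -> M = block_mx A 0 0 B.
Proof.
move=> Hl Hr; rewrite -[M]mul1mx scalar_mx_block block_mxEv mul_col_mx -Hl -Hr.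
by rewrite !mul_mx_row !mulmx1 !mulmx0 -block_mxEv.
Qed.

(** The inclusions of both summands are intertwiners, and together they determine the matrix. *)
Lemma nc_eval_dsum d (p : ncpoly F d) m n (A : 'I_d -> 'M[F]_m.+1)
    (B : 'I_d -> 'M[F]_n.+1) :
  nc_eval (fun j => dsum (A j) (B j)) p = dsum (nc_eval A p) (nc_eval B p).
Proof.
apply: (@block_diag_uniq m.+1 n.+1 (nc_eval A p) (nc_eval B p)).
  by apply: nc_eval_intertwine => j; apply: block_diag_row_mxl.
by apply: nc_eval_intertwine => j; apply: (@block_diag_row_mxr m.+1 n.+1).
Qed.

Lemma rank_row_mx_block_diag_sub m n k (A : 'M[F]_m) (B : 'M[F]_n) (S : 'M[F]_k)
    (T : 'M[F]_(m, n)) :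
  \rank (A *m row_mx T 0 - row_mx T 0 *m block_mx B 0 0 S) =
  \rank (A *m T - T *m B).
Proof.
rewrite mul_mx_row mul_row_block !mulmx0 !mul0mx !addr0.
by rewrite opp_row_mx add_row_mx subr0 rank_row_mx0.
Qed.

Lemma dsum0 m n : dsum (0 : 'M_m.+1) (0 : 'M_n.+1) = 0.
Proof. exact: (@block_mx0 F m.+1 n.+1 m.+1 n.+1). Qed.

Lemma close_dsum e d n n' k (A : 'I_d -> 'M[F]_n.+1) (B : 'I_d -> 'M[F]_n'.+1)
    (S : 'I_d -> 'M[F]_k.+1) :
  close e A B -> close (e + k.+1) A (fun j => dsum (B j) (S j)).
Proof.
move=> [T [HT rn rn']].
pose T' : 'M[F]_(n.+1, (n' + k.+1).+1) := row_mx T (0 : 'M_(n.+1, k.+1)).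
have rT' : \rank T' = \rank T by exact: (@rank_row_mx0 F n.+1 n'.+1 k.+1 T).
exists T'; rewrite rT'; split=> [j||].
- rewrite (leq_trans _ (leq_addr _ _)) // (leq_trans _ (HT j)) //.
  exact/eq_leq/(@rank_row_mx_block_diag_sub n.+1 n'.+1 k.+1 _ _ (S j)).
- by rewrite addnA (leq_trans rn) // leq_addr.
- by rewrite addnA -addSn leq_add2r.
Qed.

(** [T] is within rank [3 * e] of [Pd *m g] with [g] invertible. Replacing [T] by [Pd *m g] costs
    [3 * e] on either side of the commutator, which gives [7 * e]; the size defect adds another
    [e]. *)
Lemma close_conj e d n n' (A : 'I_d -> 'M[F]_n.+1) (B : 'I_d -> 'M[F]_n'.+1) :
  close e A B -> exists2 g : 'M[F]_n'.+1, g \in unitmx &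
    forall j, (rank_hatB (A j) (g *m B j *m invmx g) <= 8 * e)%N.
Proof.
move=> cAB; have [le_n le_n'] := close_dim cAB; case: cAB => T [HT rn rn'].
pose Pd : 'M[F]_(n.+1, n'.+1) := pid_mx n'.+1.
pose S : 'M[F]_(n'.+1, n.+1) := pid_mx n.+1.
(* [g] arises from [M] by completing the partial identity between its invertible factors, so the
   rank of [M - g] is at most the corank of [M]. *)
pose M := S *m T; pose L := col_ebase M; pose R := row_ebase M.
pose g := L *m R.
have gU : g \in unitmx by rewrite unitmx_mul col_ebase_unit row_ebase_unit.
have PS : Pd *m S = pid_mx n'.+1.
  rewrite mul_pid_mx; apply/matrixP => i j; rewrite !mxE.
  by rewrite !ltn_min ltn_ord andbT andbb.
have rMg : (\rank (M - g)%R <= n'.+1 - \rank M)%N.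
  rewrite -[X in (X - _)%R]mulmx_ebase -/L -/R /g.
  have -> : L *m pid_mx (\rank M) *m R - L *m R = - (L *m copid_mx (\rank M) *m R).
    by rewrite /copid_mx mulmxBr mulmx1 mulmxBl opprB.
  rewrite mxrank_opp (leq_trans (leq_rankM _ _ _)) //.
  by rewrite rank_copid_mx ?rank_leq_row.
clearbody g.
have rPS : (\rank (1%:M - Pd *m S)%R <= e)%N.
  rewrite PS; have [le_mm'|/ltnW le_m'm] := leqP n.+1 n'.+1.
    by rewrite -pid_mx_minv (minn_idPl le_mm') pid_mx_1 subrr mxrank0.
  by rewrite -/(copid_mx n'.+1) rank_copid_mx // leq_subLR.
have rT : (\rank T <= \rank M + e)%N.
  rewrite -[T]mul1mx -[1%:M](subrK (Pd *m S)) mulmxDl addrC.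
  rewrite (leq_trans (mxrank_add _ _)) // leq_add //.
    by rewrite -mulmxA mxrankM_maxr.
  exact: leq_trans (mxrankM_maxl _ _) rPS.
have rTg : (\rank (T - Pd *m g)%R <= 3 * e)%N.
  have -> : T - Pd *m g = (1%:M - Pd *m S) *m T + Pd *m (M - g).
    by rewrite mulmxBl mulmxBr mul1mx -mulmxA -/M subrKA.
  rewrite (leq_trans (mxrank_add _ _)) // mulSn leq_add //.
    exact: leq_trans (mxrankM_maxl _ _) rPS.
  rewrite (leq_trans (mxrankM_maxr _ _)) // (leq_trans rMg) // leq_subLR.
  by rewrite mul2n -addnn addnA (leq_trans rn') // leq_add2r.
exists g => // j; rewrite (leq_trans (rank_hatB_leq _ _)) //.
rewrite -[8%N]/(7 + 1)%N mulnDl mul1n leq_add //; last first.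
  have [le_mm'|/ltnW le_m'm] := leqP n.+1 n'.+1.
    by rewrite subnn addn0 leq_subLR.
  by rewrite subnn add0n leq_subLR.
rewrite -[X in (X <= _)%N](mxrankMfree _ (_ : row_free g)) ?row_free_unit //.
rewrite mulmxBl !mulmxA mulmxKV // -/Pd.
have -> : A j *m Pd *m g - Pd *m g *m B j =
    (A j *m T - T *m B j) -
    (A j *m (T - Pd *m g) - (T - Pd *m g) *m B j).
  rewrite mulmxBr mulmxBl !mulmxA !opprB.
  by rewrite addrA subrKA [RHS]addrC subrKA.
rewrite (leq_trans (mxrank_sub _ _)) // mulSn leq_add //.
rewrite (leq_trans (mxrank_sub _ _)) // -[6%N]/(3 + 3)%N mulnDl leq_add //.
  exact: leq_trans (mxrankM_maxr _ _) rTg.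
exact: leq_trans (mxrankM_maxl _ _) rTg.
Qed.

End Closeness.

(** * Control of the dimension *)

Section DimensionControl.
Variables (F : fieldType) (d : nat).

Lemma row_basis m n (A : 'M[F]_(m, n)) :
  exists r (V : 'M[F]_(r, n)), row_free V /\ (V :=: A)%MS.
Proof.
exists (\rank A), (row_base A); split; first exact: row_base_free.
exact: eq_row_base.
Qed.

(* The span [W] of the first [n.+1] coordinates and of the images of the [B j]
   is invariant and, since [hat A - hat B] has small rank, not much larger. *)
Lemma close_restrict n n' (A : 'I_d -> 'M[F]_n.+1) (B : 'I_d -> 'M[F]_n'.+1) e :
    (n <= n')%N -> (forall j, (rank_hatB (A j) (B j) <= e)%N) ->
  exists r (B' : 'I_d -> 'M[F]_r.+1), close (d.+1 * e) A B' /\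
    forall p, nc_eval B p = 0 -> nc_eval B' p = 0.
Proof.
move=> le_nn' HAB.
pose T : 'M[F]_(n.+1, n'.+1) := pid_mx n.+1.
pose Tt : 'M[F]_(n'.+1, n.+1) := pid_mx n.+1.
have rT : \rank T = n.+1 by rewrite rank_pid_mx.
have TTt : T *m Tt = 1%:M by apply: pid_mxK.
pose D j := Tt *m A j *m T - B j.
have rD j : (\rank (D j) <= e)%N.
  have max_nn' : n'.+1 = maxn n.+1 n'.+1 by apply/esym/maxn_idPr.
  rewrite (leq_trans _ (HAB j)) // (rank_hatBE _ _ max_nn') pid_mx_1.
  by rewrite mul1mx mulmx1.
have [r [V [Vfree VW]]] := row_basis (T + \sum_j <<B j>>)%MS.
have TV : (T <= V)%MS by rewrite VW addsmxSl.
have BV j : (B j <= V)%MS.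
  by rewrite VW (submx_trans _ (addsmxSr _ _)) // (sumsmx_sup j) // genmxE.
have rV : r = \rank V by apply/esym/eqP.
(* Up to [D j], the rows of [B j] lie in the span of [T], so each letter adds at most [e]
   dimensions. *)
have le_r : (r <= n.+1 + d * e)%N.
  have VD : (V <= T + \sum_j <<D j>>)%MS.
    rewrite VW addsmx_sub addsmxSl; apply/sumsmx_subP => j _; rewrite genmxE.
    have -> : B j = Tt *m A j *m T - D j by rewrite opprB addrC subrK.
    rewrite addmx_sub //; first by rewrite (submx_trans (submxMl _ _)) ?addsmxSl.
    rewrite eqmx_opp (submx_trans _ (addsmxSr _ _)) // (sumsmx_sup j) //.
    by rewrite genmxE.
  rewrite rV (leq_trans (mxrankS VD)) // (leq_trans (mxrank_adds_leqif _ _)) //.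
  rewrite rT leq_add2l (leq_trans (mxrank_sum_leqif _)) //=.
  rewrite (leq_trans (leq_sum _ (E2 := fun=> e) _)) ?sum_nat_const ?card_ord //.
  by move=> j _; rewrite genmxE.
(* The new size is positive since [V] spans the [n.+1] independent rows of [T]. *)
case: r V Vfree VW TV BV rV le_r => [|r] V Vfree VW TV BV rV le_r.
  by have := mxrankS TV; rewrite rT -rV.
(* In the basis [V], [T0] holds the coordinates of [T] and [B'] is the restriction of [B]. *)
pose T0 := T *m pinvmx V; pose B' j := V *m B j *m pinvmx V.
have T0V : T0 *m V = T by rewrite mulmxKpV.
have rT0 : (n.+1 <= \rank T0)%N by have := mxrankM_maxl T0 V; rewrite T0V rT.
have B'V j : B' j *m V = V *m B j.
  by rewrite mulmxKpV // (submx_trans (submxMl _ _)).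
clearbody T0 B'; exists r, B'; split.
  exists T0; split=> [j||].
  - rewrite -(mxrankMfree _ Vfree) mulmxBl -!mulmxA B'V T0V mulmxA T0V mulSn.
    rewrite (leq_trans _ (leq_addr _ _)) // (leq_trans _ (rD j)) //.
    have -> : A j *m T - T *m B j = T *m D j.
      by rewrite /D mulmxBr !mulmxA TTt mul1mx.
    exact: mxrankM_maxr.
  - by rewrite (leq_trans rT0) // leq_addr.
  - by rewrite (leq_trans le_r) // leq_add // mulSn leq_addl.
move=> p Bp; have := nc_eval_intertwine p B'V.
rewrite Bp mulmx0 => /(congr1 (mulmx^~ (pinvmx V))) /=.
by rewrite mul0mx mulmxKp.
Qed.

(* Here the last [n - n'] coordinates are nearly annihilated by the [A j], hence
   nearly scaled by the constant term of [p] under [p(A)]; unless [n - n'] is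
   small, all the constant terms vanish and [B] may be extended by zero. *)
Lemma close_extend (P : seq (ncpoly F d)) : exists C, forall n n'
    (A : 'I_d -> 'M[F]_n.+1) (B : 'I_d -> 'M[F]_n'.+1) e,
    (n' <= n)%N -> (forall j, (rank_hatB (A j) (B j) <= e)%N) ->
    (forall p, p \in P -> (\rank (nc_eval A p) <= e)%N) ->
    (forall p, p \in P -> nc_eval B p = 0) ->
  exists r (B' : 'I_d -> 'M[F]_r.+1), close (C * e) A B' /\
    forall p, p \in P -> nc_eval B' p = 0.
Proof.
have [C HC] := nc_eval_uniform P.
exists C.+2 => n n' A B e le_n'n HAB PA PB.
pose E : 'M[F]_(n.+1, n'.+1) := pid_mx n'.+1.
pose Et : 'M[F]_(n'.+1, n.+1) := pid_mx n'.+1.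
have EtE : Et *m E = 1%:M by apply: pid_mxK.
have EEt : E *m Et = pid_mx n'.+1 by rewrite mul_pid_mx !minnn.
pose U : 'M[F]_n.+1 := copid_mx n'.+1.
have UE : U *m E = 0.
  by rewrite /U /copid_mx -EEt mulmxBl mul1mx -mulmxA EtE mulmx1 subrr.
have rU : \rank U = (n - n')%N by rewrite rank_copid_mx.
have rAB j : (\rank (A j - E *m B j *m Et)%R <= e)%N.
  have max_nn' : n.+1 = maxn n.+1 n'.+1 by apply/esym/maxn_idPl.
  rewrite (leq_trans _ (HAB j)) // (rank_hatBE _ _ max_nn') pid_mx_1.
  by rewrite mul1mx mulmx1.
(* The value at the zero tuple is the constant term, as a scalar matrix. *)
have [c0|] := pselect (forall p, p \in P ->
    nc_eval (fun=> 0 : 'M[F]_n.+1) p = 0).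
  pose B' j := E *m B j *m Et; exists n, B'; split.
    apply: (@close_le _ (0 + e)%N); first by rewrite add0n leq_pmull.
    exact: close_sub rAB (close_refl _).
  (* [Et] intertwines [B] with [B'], [U] intertwines zero with [B'], and [E *m Et + U] is the
     identity. *)
  move=> p pP; have HEt : nc_eval B p *m Et = Et *m nc_eval B' p.
    by apply: nc_eval_intertwine => j; rewrite /B' !mulmxA EtE mul1mx.
  have HU : nc_eval (fun=> 0 : 'M[F]_n.+1) p *m U = U *m nc_eval B' p.
    by apply: nc_eval_intertwine => j; rewrite /B' !mulmxA UE !mul0mx.
  rewrite -[LHS]mul1mx -[1%:M](subrK (E *m Et)) {1}EEt -/(copid_mx _) -/U.
  by rewrite mulmxDl -HU -mulmxA -HEt c0 // PB // !mul0mx mulmx0 addr0.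
move=> /existsNP[p /not_implyP[pP c_neq0]].
have [c cE] : exists c, nc_eval (fun=> 0 : 'M[F]_n.+1) p = c%:M.
  elim/ncpoly_ind: (p) => [|j|q r [c Hq] [c' Hr]|q r [c Hq] [c' Hr]|c q [c' Hq]].
  - by exists 1; rewrite rmorph1.
  - by exists 0; rewrite nc_eval_letter raddf0.
  - by exists (c + c'); rewrite raddfD /= Hq Hr raddfD.
  - by exists (c * c'); rewrite rmorphM /= Hq Hr scalar_mxM.
  - by exists (c * c'); rewrite linearZ /= Hq scale_scalar_mx.
have {}c_neq0 : c != 0.
  by apply/eqP => c0; apply: c_neq0; rewrite cE c0 raddf0.
(* [U] intertwines the zero tuple with [A] up to rank [e]. Hence [c *: U], of rank [n - n'], is
   within rank [C * e] of [U *m nc_eval A p], whose rank is at most [e]. *)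
have le_nn' : (n - n' <= C.+1 * e)%N.
  have HU j : (\rank (0 *m U - U *m A j)%R <= e)%N.
    rewrite mul0mx sub0r mxrank_opp (leq_trans _ (rAB j)) //.
    have -> : U *m A j = U *m (A j - E *m B j *m Et).
      by rewrite mulmxBr !mulmxA UE !mul0mx subr0.
    exact: mxrankM_maxr.
  have := HC p _ _ (fun=> 0) A U e pP HU; rewrite cE mul_scalar_mx => HCe.
  rewrite -rU -(mxrank_scale_nz _ c_neq0) -[c *: U](subrK (U *m nc_eval A p)).
  rewrite (leq_trans (mxrank_add _ _)) // mulSn addnC leq_add //.
  exact: leq_trans (mxrankM_maxr _ _) (PA p pP).
exists n', B; split=> //; exists E; rewrite rank_pid_mx //; split=> [j||].
- rewrite mulSn (leq_trans _ (leq_addr _ _)) // (leq_trans _ (HAB j)) //.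
  exact: leq_rank_pid.
- rewrite addSn ltnS -leq_subLR (leq_trans le_nn') //.
  by rewrite leq_mul2r leqnSn orbT.
- exact: leq_addr.
Qed.

Lemma close_of_hat (P : seq (ncpoly F d)) : exists C, forall n n'
    (A : 'I_d -> 'M[F]_n.+1) (B : 'I_d -> 'M[F]_n'.+1) e,
    (forall j, (rank_hatB (A j) (B j) <= e)%N) ->
    (forall p, p \in P -> (\rank (nc_eval A p) <= e)%N) ->
    (forall p, p \in P -> nc_eval B p = 0) ->
  exists r (B' : 'I_d -> 'M[F]_r.+1), close (C * e) A B' /\
    forall p, p \in P -> nc_eval B' p = 0.
Proof.
have [C HC] := close_extend P; exists (maxn C d.+1) => n n' A B e HAB PA PB.
have [le_nn'|/ltnW le_n'n] := leqP n n'.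
  have [r [B' [cAB' B'0]]] := close_restrict le_nn' HAB.
  exists r, B'; split=> [|p /PB]; last exact: B'0.
  by apply: close_le cAB'; rewrite leq_mul2r leq_maxr orbT.
have [r [B' [cAB' B'0]]] := HC _ _ _ _ _ le_n'n HAB PA PB.
exists r, B'; split=> //.
by apply: close_le cAB'; rewrite leq_mul2r leq_maxl orbT.
Qed.

End DimensionControl.

(** * Independence of the presentation *)

Section Smallness.
Variable R : realType.

(** Absorbs a constant factor into the tolerance. Dividing by [C.+1] allows [C = 0] and makes the
    inequality strict. *)
Lemma mul_small (C : nat) (eps : R) : 0 < eps ->
  exists2 delta : R, 0 < delta & forall e n : nat,
    e%:R <= delta * n.+1%:R -> (C * e)%:R < eps * n.+1%:R.
Proof.
move=> eps0; exists (eps / C.+1%:R); first by rewrite divr_gt0.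
move=> e n; rewrite mulrAC ler_pdivlMr // => H.
have := ltr_pwDr (ltr0Sn R 0) H.
have [e0|e0] := posnP e; first by rewrite e0 muln0 mulr_gt0.
rewrite (lt_le_trans _ H) // -natrM ltr_nat mulnC ltn_pmul2l //.
Qed.

Lemma rk_lt (F : fieldType) n (M : 'M[F]_n.+1) (delta : R) :
  (rk R M < delta) = ((\rank M)%:R < delta * n.+1%:R).
Proof. by rewrite /rk ltr_pdivrMr. Qed.

(** Ranks are integers and [n.+1 / K.+1 < 1] for these sizes. Thus almost solutions of bounded size
    are exact. *)
Lemma rk_small0 (K : nat) : exists2 delta : R, 0 < delta &
  forall (F : fieldType) n (M : 'M[F]_n.+1),
    (n < K)%N -> rk R M < delta -> M = 0.
Proof.
exists K.+1%:R^-1 => [|F n M ltnK]; first by rewrite invr_gt0.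
rewrite rk_lt mulrC ltr_pdivlMr // => HM.
apply/eqP; rewrite -mxrank_eq0 -leqn0 -ltnS.
have : (\rank M)%:R * K.+1%:R < (1 * K.+1)%:R :> R.
  by rewrite (lt_le_trans HM) // mul1n ler_nat ltnW // ltnS.
by rewrite -natrM ltr_nat ltn_pmul2r.
Qed.

End Smallness.

Section Stability.
Variables (R : realType) (F : fieldType).

(* Basis-free variant of [rank_stable_presentation]; unlike the latter it bounds
   the dimension change [n' - n]. *)
Definition close_stable d (P : seq (ncpoly F d)) : Prop :=
  forall eps : R, 0 < eps ->
  exists2 delta : R, 0 < delta &
  forall n (A : 'I_d -> 'M[F]_n.+1),
    (forall p, p \in P -> rk R (nc_eval A p) < delta) ->
    exists n' (B : 'I_d -> 'M[F]_n'.+1) e,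
      [/\ forall p, p \in P -> nc_eval B p = 0,
          close e A B & e%:R <= eps * n.+1%:R].

Lemma rank_stable_close d (P : seq (ncpoly F d)) :
  rank_stable_presentation R P -> close_stable P.
Proof.
move=> stP eps eps0; have [C HC] := close_of_hat P.
have [eps1 eps1_gt0 Heps1] := mul_small C eps0.
have [delta1 delta1_gt0 Hdelta1] := stP eps1 eps1_gt0.
(* [close_of_hat] wants a single [e] for the distances and for the ranks of the relators, hence the
   minimum. *)
exists (Num.min delta1 eps1); first by rewrite lt_min delta1_gt0.
move=> n A HA; have [|n' [B [PB HB]]] := Hdelta1 n A.
  by move=> p /HA; rewrite lt_min => /andP[].
have e_ge0 : 0 <= eps1 * n.+1%:R by rewrite mulr_ge0 // ltW.
pose e := Num.truncn (eps1 * n.+1%:R).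
have [j|p pP|r [B' [cAB' PB']]] := HC _ _ A B e _ _ PB.
- by rewrite truncn_ge_nat // ltW.
- rewrite truncn_ge_nat // ltW // -rk_lt (lt_le_trans (HA p pP)) //.
  by rewrite ge_min lexx orbT.
exists r, B', (C * e)%N; split=> //; apply/ltW/Heps1.
by rewrite -truncn_ge_nat.
Qed.

Lemma close_rank_stable d (P : seq (ncpoly F d)) :
  close_stable P -> rank_stable_presentation R P.
Proof.
move=> stP eps eps0; have [eps1 eps1_gt0 Heps1] := mul_small 8 eps0.
have [delta delta_gt0 Hdelta] := stP eps1 eps1_gt0.
exists delta => // n A /Hdelta[n' [B [e [PB /close_conj[g gU Hg] He]]]].
exists n', (fun j => g *m B j *m invmx g); split=> [p /PB|j].
  exact: nc_eval_conj0.
by rewrite (le_lt_trans _ (Heps1 _ _ He)) // ler_nat.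
Qed.

(** Each term [a * p * b] has at most the rank of [p], so [C] can be the number of terms. *)
Lemma rank_in_ideal d (P : seq (ncpoly F d)) q : in_ideal P q ->
  exists C, forall n (A : 'I_d -> 'M[F]_n.+1) e,
    (forall p, p \in P -> (\rank (nc_eval A p) <= e)%N) ->
    (\rank (nc_eval A q) <= C * e)%N.
Proof.
elim/in_ideal_ind=> [|p r [C HC] [C' HC']|a p b pP].
- by exists 0%N => n A e _; rewrite raddf0 mxrank0.
- exists (C + C')%N => n A e HA; rewrite raddfD mulnDl.
  by rewrite (leq_trans (mxrank_add _ _)) // leq_add ?HC ?HC'.
exists 1%N => n A e HA; rewrite !rmorphM mul1n /=.
exact: leq_trans (leq_rankM _ _ _) (HA p pP).
Qed.

Lemma rank_in_ideal_uniform d (P : seq (ncpoly F d)) (Q : seq (ncpoly F d)) :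
  (forall q, q \in Q -> in_ideal P q) ->
  exists C, forall n (A : 'I_d -> 'M[F]_n.+1) e,
    (forall p, p \in P -> (\rank (nc_eval A p) <= e)%N) ->
    forall q, q \in Q -> (\rank (nc_eval A q) <= C * e)%N.
Proof.
(* [uniform_seq] asks for a constant for every polynomial, so membership becomes a premise; outside
   the ideal any constant will do. *)
move=> QP; have [||C HC] := @uniform_seq _ Q (fun q C => in_ideal P q ->
    forall n (A : 'I_d -> 'M[F]_n.+1) e,
    (forall p, p \in P -> (\rank (nc_eval A p) <= e)%N) ->
    (\rank (nc_eval A q) <= C * e)%N).
- move=> q c c' le_cc' Hc Pq n A e HA; rewrite (leq_trans (Hc Pq _ _ _ HA)) //.
  by rewrite leq_mul2r le_cc' orbT.
- move=> q; have [/rank_in_ideal[C HC]|nPq] := pselect (in_ideal P q).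
    by exists C.
  by exists 0%N.
by exists C => n A e HA q qQ; apply: HC HA => //; apply: QP.
Qed.

(** Let [f] express the [x i] through the [z j], and [g] the converse. An almost solution [X] of [P]
    yields the almost solution [g(X)] of [S]. If [W] is an exact solution close to it, then [f(W)]
    solves [P] and is close to [f(g(X))], which is close to [X]. *)
Lemma close_stable_presents (A : algType F) d (x : 'I_d -> A) P
    k (z : 'I_k -> A) S :
  presents x P -> presents z S -> close_stable S -> close_stable P.
Proof.
move=> presP presS stS eps eps0.
have [[surP kerP] [surS kerS]] := (presP, presS).
have [f fE] := choice (fun i => surS (x i)).
have [g gE] := choice (fun j => surP (z j)).
have [|C1 HC1] := @rank_in_ideal_uniform _ P [seq nc_subst g s | s <- S].
  move=> q /mapP[s sS ->]; apply/kerP; rewrite nc_eval_subst.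
  by rewrite (eq_nc_eval gE) (presents_gen0 presS).
(* Modulo the ideal of [P], expressing a letter through [f] and then [g] gives it back; this bounds
   the distance from [X] to [f(g(X))]. *)
have [|C2 HC2] := @rank_in_ideal_uniform _ P
    [seq letter F i - nc_subst g (f i) | i <- enum 'I_d].
  move=> q /mapP[i _ ->]; apply/kerP; rewrite raddfB /= nc_eval_letter.
  by rewrite nc_eval_subst (eq_nc_eval gE) fE subrr.
have [C3 HC3] := close_eval f.
have eps2 : 0 < eps / 2 by rewrite divr_gt0.
have [eps3 eps3_gt0 Heps3] := mul_small C3 eps2.
have [delta1 delta1_gt0 Hdelta1] := stS eps3 eps3_gt0.
have [delta2 delta2_gt0 Hdelta2] := mul_small C1 delta1_gt0.
have [delta3 delta3_gt0 Hdelta3] := mul_small C2 eps2.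
exists (Num.min delta2 delta3); first by rewrite lt_min delta2_gt0.
move=> n X HX; pose e := Num.truncn (Num.min delta2 delta3 * n.+1%:R).
have He : e%:R <= Num.min delta2 delta3 * n.+1%:R.
  by rewrite -truncn_ge_nat // mulr_ge0 // le_min !ltW.
have He2 : e%:R <= delta2 * n.+1%:R.
  by rewrite (le_trans He) // ler_pM2r // ge_min lexx.
have He3 : e%:R <= delta3 * n.+1%:R.
  by rewrite (le_trans He) // ler_pM2r // ge_min lexx orbT.
have PX p : p \in P -> (\rank (nc_eval X p) <= e)%N.
  move=> /HX; rewrite rk_lt => /ltW; rewrite -truncn_ge_nat //.
  by rewrite mulr_ge0 // le_min !ltW.
have [s sS|n' [W [e' [SW cW He']]]] := Hdelta1 n (fun j => nc_eval X (g j)).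
  rewrite rk_lt (le_lt_trans _ (Hdelta2 _ _ He2)) // ler_nat -nc_eval_subst.
  by apply: HC1 PX _ _; apply: map_f.
exists n', (fun i => nc_eval W (f i)), (C3 * e' + C2 * e)%N; split.
- move=> p pP; rewrite -nc_eval_subst; apply: eval_ideal0 SW _; apply/kerS.
  by rewrite nc_eval_subst (eq_nc_eval fE) (presents_gen0 presP).
- apply: close_sub (HC3 _ _ _ _ _ cW) => i; rewrite -nc_eval_subst.
  rewrite -[X i](nc_eval_letter X) -raddfB; apply: HC2 PX _ _.
  by apply: map_f; rewrite mem_enum.
rewrite natrD [eps]splitr mulrDl lerD // ltW //; first exact: Heps3.
exact: Hdelta3.
Qed.

End Stability.

(** * Quotient algebras *)

(** Properness is included because the quotient must be an [algType], hence nonzero. *)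
Record two_sided_ideal (F : fieldType) (E : algType F) := TwoSidedIdeal {
  in_tsideal :> E -> Prop;
  tsidealB : forall a b,
    in_tsideal a -> in_tsideal b -> in_tsideal (a - b);
  tsidealMl : forall a b, in_tsideal b -> in_tsideal (a * b);
  tsidealMr : forall a b, in_tsideal a -> in_tsideal (a * b);
  tsideal0 : in_tsideal 0;
  tsideal1 : ~ in_tsideal 1
}.

Section QuotientAlgebra.
Variables (F : fieldType) (E : algType F) (J : two_sided_ideal E).

Definition ideal_pred : {pred E} := fun a => `[< J a >].

Lemma ideal_pred_closed : zmod_closed ideal_pred.
Proof.
split=> [|a b]; first by apply/asboolP/tsideal0.
by move=> /asboolP Ja /asboolP Jb; apply/asboolP/tsidealB.
Qed.

HB.instance Definition _ := GRing.isZmodClosed.Build E ideal_pred ideal_pred_closed.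

Definition quotalg : Type := Quotient.quot ideal_pred.
HB.instance Definition _ := GRing.Zmodule.on quotalg.

Definition qproj (a : E) : quotalg := \pi_(Quotient.quot ideal_pred)%qT a.
Definition qrepr (u : quotalg) : E := repr (u : Quotient.quot ideal_pred).

Lemma qreprK : cancel qrepr qproj.
Proof. exact: reprK. Qed.

Lemma qproj_eq a b : qproj a = qproj b <-> J (a - b).
Proof.
rewrite (rwP eqP) /qproj -Quotient.idealrBE; apply: iff_sym.
exact: (rwP (asboolP _)).
Qed.

Lemma qproj_zmod_morphism : zmod_morphism qproj.
Proof. exact: raddfB. Qed.
HB.instance Definition _ :=
  GRing.isZmodMorphism.Build E quotalg qproj qproj_zmod_morphism.

(** Computed on chosen representatives; [qproj_mul] shows that the choice is immaterial. *)
Definition qmul (u v : quotalg) := qproj (qrepr u * qrepr v).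
Definition qscale (c : F) (u : quotalg) := qproj (c *: qrepr u).

Lemma qrepr_proj a : J (qrepr (qproj a) - a).
Proof. by apply/qproj_eq; rewrite qreprK. Qed.

Lemma qproj_mul a b : qproj (a * b) = qmul (qproj a) (qproj b).
Proof.
apply/esym/qproj_eq; set a' := qrepr _; set b' := qrepr _.
have -> : a' * b' - a * b = a' * (b' - b) - (- ((a' - a) * b)).
  by rewrite opprK mulrBr mulrBl addrA subrK.
apply: tsidealB; first exact/tsidealMl/qrepr_proj.
by rewrite -mulNr opprB; apply/tsidealMr/qproj_eq; rewrite qreprK.
Qed.

Lemma qproj_scale c a : qproj (c *: a) = qscale c (qproj a).
Proof.
apply/esym/qproj_eq; rewrite -scalerBr -[_ - a]mul1r scalerAl.
exact/tsidealMl/qrepr_proj.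
Qed.

Lemma qmulA : associative qmul.
Proof.
by move=> u v w; rewrite -[u]qreprK -[v]qreprK -[w]qreprK -!qproj_mul mulrA.
Qed.

Lemma qmul1l : left_id (qproj 1) qmul.
Proof. by move=> u; rewrite -[u]qreprK -!qproj_mul mul1r. Qed.

Lemma qmul1r : right_id (qproj 1) qmul.
Proof. by move=> u; rewrite -[u]qreprK -!qproj_mul mulr1. Qed.

Lemma qmulDl : left_distributive qmul +%R.
Proof.
move=> u v w; rewrite -[u]qreprK -[v]qreprK -[w]qreprK.
by rewrite -(raddfD qproj) -!qproj_mul mulrDl raddfD.
Qed.

Lemma qmulDr : right_distributive qmul +%R.
Proof.
move=> u v w; rewrite -[u]qreprK -[v]qreprK -[w]qreprK.
by rewrite -(raddfD qproj) -!qproj_mul mulrDr raddfD.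
Qed.

Lemma qone_neq0 : qproj 1 != 0.
Proof.
apply/eqP; rewrite -(raddf0 qproj) => /qproj_eq; rewrite subr0.
exact: tsideal1.
Qed.

HB.instance Definition _ := GRing.Zmodule_isNzRing.Build quotalg
  qmulA qmul1l qmul1r qmulDl qmulDr qone_neq0.

Lemma qscaleA c c' u : qscale c (qscale c' u) = qscale (c * c') u.
Proof. by rewrite -[u]qreprK -!qproj_scale scalerA. Qed.

Lemma qscale1 : left_id 1 qscale.
Proof. by move=> u; rewrite -[u]qreprK -!qproj_scale scale1r. Qed.

Lemma qscaleDr : right_distributive qscale +%R.
Proof.
move=> c u v; rewrite -[u]qreprK -[v]qreprK.
by rewrite -(raddfD qproj) -!qproj_scale scalerDr raddfD.
Qed.

Lemma qscaleDl u : {morph qscale^~ u : c c' / c + c'}.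
Proof.
by move=> c c'; rewrite /= -[u]qreprK -!qproj_scale scalerDl raddfD.
Qed.

HB.instance Definition _ := GRing.Zmodule_isLmodule.Build F quotalg
  qscaleA qscale1 qscaleDr qscaleDl.

Lemma qscaleAl (c : F) (u v : quotalg) : c *: (u * v) = c *: u * v.
Proof.
change (qscale c (qmul u v) = qmul (qscale c u) v).
by rewrite -[u]qreprK -[v]qreprK -!(qproj_mul, qproj_scale) scalerAl.
Qed.

HB.instance Definition _ := GRing.Lmodule_isLalgebra.Build F quotalg qscaleAl.

Lemma qscaleAr (c : F) (u v : quotalg) : c *: (u * v) = u * (c *: v).
Proof.
change (qscale c (qmul u v) = qmul u (qscale c v)).
by rewrite -[u]qreprK -[v]qreprK -!(qproj_mul, qproj_scale) scalerAr.
Qed.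

HB.instance Definition _ := GRing.Lalgebra_isAlgebra.Build F quotalg qscaleAr.

Lemma qproj_monoid_morphism : monoid_morphism qproj.
Proof. by split=> // a b; apply: qproj_mul. Qed.
HB.instance Definition _ :=
  GRing.isMonoidMorphism.Build E quotalg qproj qproj_monoid_morphism.

Lemma qproj_scalable : scalable qproj.
Proof. by move=> c a; apply: qproj_scale. Qed.
HB.instance Definition _ :=
  GRing.isScalable.Build F E quotalg _ qproj qproj_scalable.

End QuotientAlgebra.

(** * Presentation of a free product *)

Section Presentations.
Variable F : fieldType.

(** Each element is lifted to a polynomial, which is evaluated at [u]. Two lifts differ by an
    element of the ideal of [P], which vanishes at [u]; this gives all the morphism laws. *)
Lemma presents_factor (A D : algType F) d (x : 'I_d -> A) (P : seq (ncpoly F d))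
    (u : 'I_d -> D) :
  presents x P -> (forall p, p \in P -> nc_eval u p = 0) ->
  exists f : {lrmorphism A -> D}, forall j, f (x j) = u j.
Proof.
move=> [surP kerP] uP; have [g gE] := choice surP.
pose f a := nc_eval u (g a).
have fE q : f (nc_eval x q) = nc_eval u q.
  apply/eqP; rewrite /f -subr_eq0 -raddfB; apply/eqP; apply: eval_ideal0 uP _.
  by apply/kerP; rewrite raddfB /= gE subrr.
have fB : zmod_morphism f.
  by move=> a b; rewrite -[a]gE -[b]gE -raddfB !fE raddfB.
have fM : monoid_morphism f.
  split=> [|a b]; first by rewrite -(rmorph1 (nc_eval x)) fE rmorph1.
  by rewrite -[a]gE -[b]gE -rmorphM !fE rmorphM.
have fZ : scalable f.
  by move=> c a; rewrite -[a]gE -linearZ !fE linearZ.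
pose ff : {lrmorphism A -> D} := HB.pack f (GRing.isZmodMorphism.Build A D f fB)
  (GRing.isMonoidMorphism.Build A D f fM) (GRing.isScalable.Build F A D _ f fZ).
exists ff => j; change (f (x j) = u j).
by rewrite -(nc_eval_letter x) fE nc_eval_letter.
Qed.

Definition inj_left d e : ncpoly F d -> ncpoly F (d + e) :=
  nc_subst (fun j => letter F (lshift e j)).
Definition inj_right d e : ncpoly F e -> ncpoly F (d + e) :=
  nc_subst (fun j => letter F (rshift d j)).

Definition joint T d e (x : 'I_d -> T) (y : 'I_e -> T) (k : 'I_(d + e)) : T :=
  match split k with inl j => x j | inr j => y j end.

Lemma joint_lshift T d e (x : 'I_d -> T) (y : 'I_e -> T) j :
  joint x y (lshift e j) = x j.
Proof. by rewrite /joint (unsplitK (inl j)). Qed.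

Lemma joint_rshift T d e (x : 'I_d -> T) (y : 'I_e -> T) j :
  joint x y (rshift d j) = y j.
Proof. by rewrite /joint (unsplitK (inr j)). Qed.

Definition joint_relators d e (P : seq (ncpoly F d)) (Q : seq (ncpoly F e)) :
    seq (ncpoly F (d + e)) :=
  [seq inj_left e p | p <- P] ++ [seq inj_right d q | q <- Q].

Lemma eval_inj_left (A : algType F) d e (z : 'I_(d + e) -> A) p :
  nc_eval z (inj_left e p) = nc_eval (fun j => z (lshift e j)) p.
Proof.
by rewrite nc_eval_subst; apply: eq_nc_eval => j; rewrite nc_eval_letter.
Qed.

Lemma eval_inj_right (A : algType F) d e (z : 'I_(d + e) -> A) p :
  nc_eval z (inj_right d p) = nc_eval (fun j => z (rshift d j)) p.
Proof.
by rewrite nc_eval_subst; apply: eq_nc_eval => j; rewrite nc_eval_letter.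
Qed.

Lemma eval_joint_relators (A : algType F) d e (P : seq (ncpoly F d))
    (Q : seq (ncpoly F e)) (z : 'I_(d + e) -> A) (K : A -> Prop) :
  (forall s, s \in joint_relators P Q -> K (nc_eval z s)) <->
  (forall p, p \in P -> K (nc_eval (fun j => z (lshift e j)) p)) /\
  (forall q, q \in Q -> K (nc_eval (fun j => z (rshift d j)) q)).
Proof.
split=> [H|[HP HQ] s].
  split=> [p pP|q qQ].
    by rewrite -eval_inj_left; apply: H; rewrite mem_cat map_f.
  by rewrite -eval_inj_right; apply: H; rewrite mem_cat map_f ?orbT.
rewrite mem_cat => /orP[/mapP[p pP ->]|/mapP[q qQ ->]].
  by rewrite eval_inj_left; apply: HP.
by rewrite eval_inj_right; apply: HQ.
Qed.

Lemma is_free_product_sym (A A' C : algType F) (i : {lrmorphism A -> C})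
    (i' : {lrmorphism A' -> C}) : is_free_product i i' -> is_free_product i' i.
Proof.
move=> fpC D f f'; have [h [hi hi' huniq]] := fpC D f' f.
by exists h; split=> // k ki ki' c; apply: huniq.
Qed.

(** The quotient [D] by the joint relators receives a map [h] from [C] by universality and maps back
    by [k] through its presentation. As [k] inverts [h] on the left, generation and relations pass
    from [D] to [C]. *)
Lemma presents_free_product (A A' C : algType F) (i : {lrmorphism A -> C})
    (i' : {lrmorphism A' -> C}) d (x : 'I_d -> A) P e (y : 'I_e -> A') Q :
  is_free_product i i' -> presents x P -> presents y Q ->
  presents (joint (i \o x) (i' \o y)) (joint_relators P Q).
Proof.
move=> fpC presP presQ; set z := joint _ _; set PQ := joint_relators P Q.
have zl j : z (lshift e j) = i (x j) by rewrite /z joint_lshift.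
have zr j : z (rshift d j) = i' (y j) by rewrite /z joint_rshift.
have evl p : nc_eval (fun j => z (lshift e j)) p = i (nc_eval x p).
  by rewrite lrmorph_nc_eval; apply: eq_nc_eval.
have evr p : nc_eval (fun j => z (rshift d j)) p = i' (nc_eval y p).
  by rewrite lrmorph_nc_eval; apply: eq_nc_eval.
have zPQ s : s \in PQ -> nc_eval z s = 0.
  apply: (eval_joint_relators P Q z (fun c => c = 0)).2; split=> p.
    by rewrite evl => /(presents_gen0 presP) ->; rewrite raddf0.
  by rewrite evr => /(presents_gen0 presQ) ->; rewrite raddf0.
(* The joint relators hold in [C], where 1 is not 0. *)
have proper1 : ~ in_ideal PQ 1.
  by move=> /(eval_ideal0 zPQ)/eqP; rewrite rmorph1 oner_eq0.
pose J : two_sided_ideal (freealg F (d + e)) := @TwoSidedIdeal F (freealg F (d + e))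
  (in_ideal PQ) (@in_idealB _ _ _) (@in_idealMl _ _ _)
  (fun a b => @in_idealMr _ _ _ a b) (@in_ideal0 _ _ _) proper1.
pose D : algType F := quotalg J.
pose w k : D := qproj J (letter F k).
have wE q : nc_eval w q = qproj J q.
  pose phi : {lrmorphism freealg F (d + e) -> D} := qproj J.
  exact/esym/(@lrmorph_ncpoly F (d + e) D phi).
have w0 q : nc_eval w q = 0 <-> in_ideal PQ q.
  by rewrite wE -(raddf0 (qproj J)) qproj_eq subr0.
have presD : presents w PQ.
  by split=> // a; exists (qrepr a); rewrite wE qreprK.
have [wP wQ] := (eval_joint_relators P Q w (fun c => c = 0)).1
  (fun s sPQ => (w0 s).2 (in_ideal_gen sPQ)).
have [f fE] := presents_factor presP wP.
have [f' f'E] := presents_factor presQ wQ.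
have [h [hi hi' _]] := fpC D f f'.
have hz q : h (nc_eval z q) = nc_eval w q.
  rewrite lrmorph_nc_eval; apply: eq_nc_eval => k; rewrite /z /joint.
  by case: (split_ordP k) => j -> /=; rewrite ?hi ?hi' ?fE ?f'E.
have [k kw] := presents_factor presD zPQ.
have kwE q : k (nc_eval w q) = nc_eval z q.
  by rewrite lrmorph_nc_eval; apply: eq_nc_eval.
(* With [C] itself as target, [k \o h] and the identity both extend [i] and [i'], so they agree. *)
have [h0 [_ _ h0uniq]] := fpC C i i'.
have kh c : k (h c) = c.
  rewrite -[LHS]/((k \o h) c) h0uniq => [|a|a'] /=.
  - by rewrite -(h0uniq idfun).
  - have [q <-] := presP.1 a; rewrite hi lrmorph_nc_eval.
    rewrite (eq_nc_eval fE) -eval_inj_left kwE eval_inj_left.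
    by rewrite evl.
  - have [q <-] := presQ.1 a'; rewrite hi' lrmorph_nc_eval.
    rewrite (eq_nc_eval f'E) -eval_inj_right kwE eval_inj_right.
    by rewrite evr.
split=> [c|q].
  by exists (qrepr (h c)); rewrite -kwE wE qreprK kh.
split=> [zq0|]; last exact: eval_ideal0.
by apply/w0; rewrite -hz zq0 raddf0.
Qed.

End Presentations.

(** * Dimensions of representations *)

Section RepresentationDimensions.

(** If [t] in [S] has the residue of [N], then [t * L.-1] complements [N] to a multiple of [L]. One
    [t] per residue class met by [S] suffices, hence the uniform bound. *)
Lemma residue_complement (S : nat -> Prop) (L : nat) :
    (0 < L)%N -> S 0%N -> (forall a b, S a -> S b -> S (a + b)%N) ->
  exists M, forall N, S N -> exists s, [/\ S s, (s <= M)%N & (L %| N + s)%N].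
Proof.
move=> L0 S0 SD.
have Smul k a : S a -> S (a * k)%N.
  by move=> Sa; elim: k => [|k IHk]; rewrite ?muln0 // mulnS; apply: SD.
have /choice[M HM] : forall r : 'I_L, exists M, forall N, S N -> (N %% L = r)%N ->
    exists s, [/\ S s, (s <= M)%N & (L %| N + s)%N].
  move=> r.
  have [[t [St tr]]|no] := pselect (exists t, S t /\ (t %% L = r)%N); last first.
    by exists 0%N => N SN Nr; case: no; exists N.
  exists (t * L.-1)%N => N SN Nr; exists (t * L.-1)%N; split=> //.
    exact: Smul.
  rewrite /dvdn -modnDml Nr -tr modnDml -mulnS prednK //.
  by rewrite modnMl.
exists (\max_r M r) => N SN.
have [s [Ss le_s dvd_s]] := HM (Ordinal (ltn_pmod N L0)) N SN (erefl _).
by exists s; split=> //; rewrite (leq_trans le_s) // leq_bigmax.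
Qed.

(** Both numbers are first completed to multiples of [L] at bounded cost; the smaller one is then
    raised by copies of [L]. Of the two truncated differences in the witnesses, at least one is
    0. *)
Lemma common_extension (S S' : nat -> Prop) (L : nat) :
    (0 < L)%N -> S 0%N -> (forall a b, S a -> S b -> S (a + b)%N) ->
    S' 0%N -> (forall a b, S' a -> S' b -> S' (a + b)%N) -> S L -> S' L ->
  exists M, forall N N', S N -> S' N' -> exists s s',
    [/\ S s, S' s', (N + s = N' + s')%N, (s <= M + (N' - N))%N &
        (s' <= M + (N - N'))%N].
Proof.
move=> L0 S0 SD S'0 S'D SL S'L.
have [M HM] := residue_complement L0 S0 SD.
have [M' HM'] := residue_complement L0 S'0 S'D.
exists (M + M')%N => N N' /HM[s [Ss le_s dvd_s]] /HM'[s' [Ss' le_s' dvd_s']].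
have mulL (T : nat -> Prop) k : T 0%N -> (forall a b, T a -> T b -> T (a + b)%N) ->
    T L -> (L %| k)%N -> T k.
  move=> T0 TD TL /dvdnP[q ->]; elim: q => [|q IHq]; first by rewrite mul0n.
  by rewrite mulSn; apply: TD.
exists (s + (N' + s' - (N + s)))%N, (s' + (N + s - (N' + s')))%N; split; try lia.
- by apply: (SD) => //; apply: (mulL S _ S0 SD SL); apply: dvdn_sub.
- by apply: (S'D) => //; apply: (mulL S' _ S'0 S'D S'L); apply: dvdn_sub.
Qed.

Variable F : fieldType.

Definition is_rep d (P : seq (ncpoly F d)) n (B : 'I_d -> 'M[F]_n.+1) : Prop :=
  forall p, p \in P -> nc_eval B p = 0.

Definition rep_dim d (P : seq (ncpoly F d)) (s : nat) : Prop :=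
  if s is k.+1 then exists B : 'I_d -> 'M[F]_k.+1, is_rep P B else True.

Lemma is_rep_dsum d (P : seq (ncpoly F d)) m n (A : 'I_d -> 'M[F]_m.+1)
    (B : 'I_d -> 'M[F]_n.+1) :
  is_rep P A -> is_rep P B -> is_rep P (fun j => dsum (A j) (B j)).
Proof. by move=> PA PB p pP; rewrite nc_eval_dsum PA // PB // dsum0. Qed.

Lemma rep_dimD d (P : seq (ncpoly F d)) a b :
  rep_dim P a -> rep_dim P b -> rep_dim P (a + b).
Proof.
case: a => [//|a]; case: b => [|b]; first by rewrite addn0.
by move=> [A PA] [B PB]; exists (fun j => dsum (A j) (B j)); apply: is_rep_dsum.
Qed.

Lemma rep_dim_mul d (P : seq (ncpoly F d)) a k : rep_dim P a -> rep_dim P (a * k).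
Proof.
by move=> Pa; elim: k => [|k IHk]; rewrite ?muln0 // mulnS; apply: rep_dimD.
Qed.

Lemma close_extend_rep d (P : seq (ncpoly F d)) e n n' (A : 'I_d -> 'M[F]_n.+1)
    (B : 'I_d -> 'M[F]_n'.+1) s :
  close e A B -> is_rep P B -> rep_dim P s ->
  exists B' : 'I_d -> 'M[F]_((n' + s).+1), close (e + s) A B' /\ is_rep P B'.
Proof.
case: s => [|s] cAB PB; first by rewrite !addn0; exists B.
move=> [S PS]; exists (fun j => dsum (B j) (S j)).
by split; [apply: close_dsum | apply: is_rep_dsum].
Qed.

(** Copies of [B] fill the space up to at most [m] dimensions, where the letters act by zero. *)
Lemma almost_rep_every_dim d (P : seq (ncpoly F d)) m (B : 'I_d -> 'M[F]_m.+1) :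
  is_rep P B -> forall n, exists Y : 'I_d -> 'M[F]_n.+1,
    forall p, p \in P -> (\rank (nc_eval Y p) <= m)%N.
Proof.
move=> PB n; elim/ltn_ind: n => n IHn.
have [lt_nm|le_mn] := ltnP n m.
  by exists (fun=> 0) => p _; apply: leq_trans (rank_leq_row _) _.
have [eq_nm|neq_nm] := eqVneq n m.
  by rewrite eq_nm; exists B => p /PB ->; rewrite mxrank0.
have lt_mn : (m < n)%N by rewrite ltn_neqAle eq_sym neq_nm.
have defn : n = (m + (n - m.+1).+1)%N by lia.
have [|Y HY] := IHn (n - m.+1)%N; first by lia.
rewrite defn; exists (fun j => dsum (B j) (Y j)) => p pP.
rewrite nc_eval_dsum PB // /dsum.
apply: leq_trans (HY p pP); apply/eq_leq.
have := @rank_diag_block_mx F m.+1 m.+1 _ _ 0 (nc_eval Y p).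
by rewrite mxrank0 add0n.
Qed.

End RepresentationDimensions.

(** * Stability of free products and of their factors *)

Section FreeProduct.
Variables (R : realType) (F : fieldType).

Lemma large_dim (m : nat) (delta : R) : 0 < delta ->
  exists K : nat, forall n, (K <= n)%N -> m%:R < delta * n.+1%:R.
Proof.
move=> delta0; exists (Num.truncn (m%:R / delta)) => n le_Kn.
rewrite mulrC -ltr_pdivrMr //.
have := truncnS_gt (m%:R / delta); move=> /lt_le_trans -> //.
by rewrite ler_nat ltnS.
Qed.

Lemma close_stable_left d e (P : seq (ncpoly F d)) (Q : seq (ncpoly F e)) m
    (rho : 'I_e -> 'M[F]_m.+1) :
  is_rep Q rho -> close_stable R (joint_relators P Q) -> close_stable R P.
Proof.
move=> Qrho stPQ eps eps0; have [delta1 delta1_gt0 Hdelta1] := stPQ eps eps0.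
have [K HK] := large_dim m delta1_gt0.
have [delta2 delta2_gt0 Hdelta2] := rk_small0 R K.
exists (Num.min delta1 delta2); first by rewrite lt_min delta1_gt0.
(* Below [K], [X] is already exact; from [K] on, the error [m] of the completion is below the
   tolerance. *)
move=> n X HX; have [lt_nK|le_Kn] := ltnP n K.
  exists n, X, 0%N; split=> [p pP||]; [|exact: close_refl|].
    by apply: (Hdelta2 _ _ _ lt_nK); have := HX p pP; rewrite lt_min => /andP[].
  by rewrite mulr_ge0 // ltW.
have [Y HY] := almost_rep_every_dim Qrho n.
have [|n' [B [e' [PQB [T [HT rn rn']] He']]]] := Hdelta1 n (joint X Y).
  apply/(eval_joint_relators P Q _ (fun M => rk R M < delta1)).
  split=> [p pP|q qQ].
    rewrite (eq_nc_eval (joint_lshift X Y)).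
    by have := HX p pP; rewrite lt_min => /andP[].
  rewrite (eq_nc_eval (joint_rshift X Y)) rk_lt.
  by rewrite (le_lt_trans _ (HK n le_Kn)) // ler_nat HY.
have [PB _] := (eval_joint_relators P Q B (fun M => M = 0)).1 PQB.
exists n', (fun j => B (lshift e j)), e'; split=> //.
by exists T; split=> // j; have := HT (lshift e j); rewrite joint_lshift.
Qed.

Lemma stable_joint d e (P : seq (ncpoly F d)) (Q : seq (ncpoly F e)) m m'
    (rho : 'I_d -> 'M[F]_m.+1) (sigma : 'I_e -> 'M[F]_m'.+1) :
  is_rep P rho -> is_rep Q sigma -> close_stable R P -> close_stable R Q ->
  rank_stable_presentation R (joint_relators P Q).
Proof.
move=> Prho Qsigma stP stQ eps eps0.
have Pm : rep_dim P m.+1 by exists rho.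
have Qm' : rep_dim Q m'.+1 by exists sigma.
have PL := rep_dim_mul m'.+1 Pm.
have QL : rep_dim Q (m.+1 * m'.+1) by rewrite mulnC; apply: rep_dim_mul.
have L0 : (0 < m.+1 * m'.+1)%N by rewrite muln_gt0.
have [M HM] :=
  common_extension L0 I (@rep_dimD F d P) I (@rep_dimD F e Q) PL QL.
(* With [E] the maximum of [M], [e1] and [e2], each tuple ends up [4 * E]-close to its half of [X],
   and [close_conj] multiplies this by 8; 40 is ample. *)
have [eps1 eps1_gt0 Heps1] := mul_small 40 eps0.
have [deltaP deltaP_gt0 HdeltaP] := stP eps1 eps1_gt0.
have [deltaQ deltaQ_gt0 HdeltaQ] := stQ eps1 eps1_gt0.
have [K HK] := large_dim M eps1_gt0.
have [delta0 delta0_gt0 Hdelta0] := rk_small0 R K.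
exists (Num.min delta0 (Num.min deltaP deltaQ)).
  by rewrite !lt_min delta0_gt0 deltaP_gt0.
move=> n X HX; have [lt_nK|le_Kn] := ltnP n K.
  exists n, X; split=> [s /HX|k].
    by rewrite lt_min => /andP[/(Hdelta0 _ _ _ lt_nK)].
  rewrite (rank_hatBE _ _ (esym (maxnn _))) subrr mxrank0.
  by rewrite mulr_gt0.
have [HXP HXQ] := (eval_joint_relators P Q X (fun M => rk R M < _)).1 HX.
have [|n1 [B [e1 [PB cB He1]]]] := HdeltaP n (fun j => X (lshift e j)).
  by move=> p /HXP; rewrite !lt_min => /and3P[].
have [|n2 [B' [e2 [QB' cB' He2]]]] := HdeltaQ n (fun j => X (rshift d j)).
  by move=> p /HXQ; rewrite !lt_min => /and3P[].
have [s [s' [Ps Qs' eq_dim le_s le_s']]] :=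
  HM n1.+1 n2.+1 (ex_intro _ B PB) (ex_intro _ B' QB').
have [le1 le1'] := close_dim cB; have [le2 le2'] := close_dim cB'.
have [C [cC PC]] := close_extend_rep cB PB Ps.
have [C' [cC' QC']] := close_extend_rep cB' QB' Qs'.
(* Both solutions now have the same size, so they can form one tuple. *)
have eq_n : (n2 + s' = n1 + s)%N by lia.
rewrite eq_n in C' cC' QC'.
(* The two halves may be conjugated by different matrices, since no joint relator mixes their
   letters. *)
have [g gU Hg] := close_conj cC; have [g' g'U Hg'] := close_conj cC'.
pose E := maxn M (maxn e1 e2).
have HE : (40 * E)%:R < eps * n.+1%:R.
  by apply: Heps1; rewrite /E /maxn; do 2?case: ifP => _ //; apply/ltW/HK.
exists (n1 + s)%N, (joint (fun j => g *m C j *m invmx g)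
                          (fun j => g' *m C' j *m invmx g')); split.
  apply/(eval_joint_relators P Q _ (fun M => M = 0)); split=> [p /PC|q /QC'].
    by rewrite (eq_nc_eval (joint_lshift _ _)); apply: nc_eval_conj0.
  by rewrite (eq_nc_eval (joint_rshift _ _)); apply: nc_eval_conj0.
move=> k; rewrite (le_lt_trans _ HE) // ler_nat /joint.
case: (split_ordP k) => j -> /=.
  by rewrite (leq_trans (Hg j)) //; lia.
by rewrite (leq_trans (Hg' j)) //; lia.
Qed.

Lemma is_rep_lrmorph (A : algType F) d (x : 'I_d -> A) P n
    (f : {lrmorphism A -> 'M[F]_n.+1}) :
  presents x P -> is_rep P (fun j => f (x j)).
Proof.
move=> presP p pP.
by rewrite -(lrmorph_nc_eval f) (presents_gen0 presP pP) raddf0.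
Qed.

(** The presentation witnessing the stability of [C] is arbitrary, so stability is first transferred
    to the joint presentation. *)
Lemma rank_stable_free_factor (A A' C : algType F)
    (i : {lrmorphism A -> C}) (i' : {lrmorphism A' -> C}) :
  is_free_product i i' ->
  finitely_presented A -> finitely_presented A' -> has_findim_rep A' ->
  rank_stable R C -> rank_stable R A.
Proof.
move=> fpC [d [x [P presP]]] [e [y [Q presQ]]] [m [f]] [k [z [S [presS stS]]]].
exists d, x, P; split=> //; apply: close_rank_stable.
apply: (close_stable_left (is_rep_lrmorph f presQ)).
apply: (close_stable_presents (presents_free_product fpC presP presQ) presS).
exact: rank_stable_close.
Qed.

End FreeProduct.

Theorem proposition7p1 (R : realType) (F : fieldType) (A A' C : algType F)
    (i : {lrmorphism A -> C}) (i' : {lrmorphism A' -> C}) :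
  is_free_product i i' ->
  finitely_presented A -> finitely_presented A' ->
  has_findim_rep A -> has_findim_rep A' ->
  rank_stable R C <-> rank_stable R A /\ rank_stable R A'.
Proof.
move=> fpC fpA fpA' repA repA'; split=> [stC|].
  split; first exact: rank_stable_free_factor stC.
  exact: (rank_stable_free_factor (is_free_product_sym fpC)) stC.
move=> [[d [x [P [presP stP]]]] [e [y [Q [presQ stQ]]]]].
move: repA repA' => [m [f]] [m' [f']].
exists (d + e)%N, (joint (i \o x) (i' \o y)), (joint_relators P Q); split.
  exact: presents_free_product.
apply: (stable_joint (is_rep_lrmorph f presP) (is_rep_lrmorph f' presQ)).
  exact: rank_stable_close.
exact: rank_stable_close.
Qed.
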